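(* Let $n\ge 1$ be a fixed integer, let $\phi\in(0,1)$, and let $m\ge 1$. Consider a sliding window consisting of $n$ sub-windows, the $i$-th sub-window containing the data points $x_{i,1},\dots,x_{i,m}$, so that the window contains the $nm$ data points $x=\{x_{i,j}: 1\le i\le n,\ 1\le j\le m\}$. Suppose the $x_{i,j}$ are independent and identically distributed with a continuous distribution having probability density $f$, and let $p_\phi$ be the $\phi$-quantile of this distribution, with $f(p_\phi)>0$. Let $y_i$ be the sample $\phi$-quantile of the $i$-th sub-window $\{x_{i,1},\dots,x_{i,m}\}$, let $y_a=\frac1n\sum_{i=1}^n y_i$, and let $y_e$ be the sample $\phi$-quantile of the whole window $x$. Then for every $\alpha\in(0,1)$, asymptotically as $m\to\infty$ (with $n$ fixed), with probability at least $1-\alpha$, \[ |y_a-y_e|\le \frac{2\,\Phi^{-1}(\alpha/2)\sqrt{\phi(1-\phi)}}{\sqrt{nm}\,f(p_\phi)}, \] i.e. $\liminf_{m\to\infty}\Pr\!\left(|y_a-y_e|\le \frac{2\Phi^{-1}(\alpha/2)\sqrt{\phi(1-\phi)}}{\sqrt{nm}\,f(p_\phi)}\right)\ge 1-\alpha$. In particular, for $\alpha=5\%$, asymptotically as $m\to\infty$, with probability at least $95\%$, \[ |y_a-y_e|\le \frac{2\times 1.96\sqrt{\phi(1-\phi)}}{\sqrt{nm}\,f(p_\phi)}. \]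
   Context: For a finite collection of $N$ values sorted increasingly as $e_1\le\dots\le e_N$, the sample $\phi$-quantile ($0<\phi\le 1$) is $e_{\lceil \phi N\rceil}$. Here $\Phi^{-1}(\beta)$ denotes the upper $\beta$-quantile of the standard normal distribution, i.e. the value $z$ with $\Pr(Z>z)=\beta$ for $Z\sim\mathcal N(0,1)$, where $\Phi$ is the cumulative distribution function of the standard normal distribution (so $\Phi^{-1}(0.025)=1.96$).
   Formalization: The density f is additionally assumed continuous at p_φ; without this f(p_φ) is not determined by the distribution and the claim fails (e.g. f(x)=(3/2)x² on [-1,1] with f(0) set to 1, φ=1/2, n=2). *)

(* Defs.v *)
From HB Require Import structures.
From mathcomp Require Import all_boot all_order all_algebra.
From mathcomp Require Import all_classical all_reals all_analysis.
Set Implicit Arguments. Unset Strict Implicit. Unset Printing Implicit Defensive.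
Import Order.TTheory GRing.Theory Num.Theory numFieldNormedType.Exports.
Local Open Scope classical_set_scope.
Local Open Scope ring_scope.

(* Sample phi-quantile of a finite collection s of N values sorted
   increasingly e_1 <= ... <= e_N : the value e_{ceil(phi N)}
   (1-based), i.e. index ceil(phi N) - 1 in the 0-based sorted list. *)
Definition sample_quantile {R : realType} (phi : R) (s : seq R) : R :=
  nth 0 (sort <=%R s) (`|Num.ceil (phi * (size s)%:R)|%N).-1.

Definition normal_upper_quantile {R : realType} (beta : R) : R :=
  xget 0 [set z : R | normal_prob 0 1 `]z, +oo[ = beta%:E].

Definition mutually_independent {R : realType} {d : measure_display}
  {T : measurableType d} (P : probability T R) (I : finType)
  (Y : I -> T -> R) : Prop :=
  forall B : I -> set R, (forall k, measurable (B k)) ->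
    P (\bigcap_(k in [set: I]) (Y k @^-1` B k)) =
    (\prod_(k : I) P (Y k @^-1` B k))%E.

Definition subwindow_quantile {R : realType} {T : Type} (n m : nat) (phi : R)
  (X : 'I_n -> 'I_m -> T -> R) (i : 'I_n) (w : T) : R :=
  sample_quantile phi [seq X i j w | j <- enum 'I_m].

Definition y_avg {R : realType} {T : Type} (n m : nat) (phi : R)
  (X : 'I_n -> 'I_m -> T -> R) (w : T) : R :=
  (n%:R)^-1 * \sum_(i < n) subwindow_quantile phi X i w.

Definition y_exact {R : realType} {T : Type} (n m : nat) (phi : R)
  (X : 'I_n -> 'I_m -> T -> R) (w : T) : R :=
  sample_quantile phi [seq X k.1 k.2 w | k : 'I_n * 'I_m].

(* Main.v *)
Require Import Defs.
From HB Require Import structures.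
From mathcomp Require Import all_boot all_order all_algebra.
From mathcomp Require Import all_classical all_reals all_analysis.
From mathcomp Require Import measurable_realfun ring lra.
Import Order.TTheory GRing.Theory Num.Theory numFieldNormedType.Exports.
Local Open Scope classical_set_scope.
Local Open Scope ring_scope.

(** Bahadur-Ghosh representation: a sample quantile [y] of [N] points is
    determined by the counting function, [y <= t] iff [phi N <= #{x <= t}].
    At the scale [1 / sqrt m], i.e. for [t = p + u / (f(p) sqrt m)], Chebyshev
    shows that [#{x <= t} - #{x <= p}] differs from its mean, about
    [u sqrt m], by [o(sqrt m)] with high probability.  Doing this for finitely
    many [u] yields [y_i = p - D_i / (m f(p)) + o(1 / sqrt m)], where
    [D_i = #{j : x_ij <= p} - phi m], and likewise
    [y_e = p - (sum_i D_i) / (n m f(p)) + o(1 / sqrt m)].  The linear terms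
    cancel in [y_a - y_e], which is therefore [o(1 / sqrt m)] in probability:
    the bound holds with probability tending to [1] for any positive constant
    in place of the normal quantile. *)

(** * Interval integrals and the tail of the normal law *)

Lemma integral_itvoc_bounds (R : realType) (f : R -> R) (a b c1 c2 : R) :
  a <= b -> 0 <= c1 -> measurable_fun setT f ->
  (forall x, x \in `]a, b] -> c1 <= f x <= c2) ->
  ((c1 * (b - a))%:E <= \int[lebesgue_measure]_(x in `]a, b]) (f x)%:E
    <= (c2 * (b - a))%:E)%E.
Proof.
move=> ab c10 mf fc.
have mE c : (\int[@lebesgue_measure R]_(x in `]a, b]) c%:E = (c * (b - a))%:E)%E.
  rewrite integral_cst//= lebesgue_measure_itv/= lte_fin.
  move: ab; rewrite le_eqVlt => /predU1P[->|->]; last by rewrite -EFinD -EFinM.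
  by rewrite ltxx subrr mulr0 mule0.
have mfE : measurable_fun `]a, b] (EFin \o f).
  by apply/measurable_EFinP; exact: measurable_funTS.
rewrite -!mE; apply/andP; split; apply: ge0_le_integral => //=.
- by move=> x /fc /andP[? _]; rewrite lee_fin.
- by move=> x /fc /andP[h _]; rewrite lee_fin (le_trans c10 h).
- by move=> x /fc /andP[_ h]; rewrite lee_fin.
Qed.

Section normal_tail.
Variable R : realType.

(** The identity, seen as a random variable under the normal law: its complementary distribution
    function is the tail, whose limit at infinity is thereby available. *)
Let idR : measurableTypeR R -> R := idfun.

#[local] HB.instance Definition _ :=
  @isMeasurableFun.Build _ _ _ _ idR (@measurable_id _ _ setT).

Let tail (z : R) : R := fine (normal_prob 0 1 `]z, +oo[).

Let tailE (z : R) : normal_prob 0 1 `]z, +oo[ = (tail z)%:E.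
Proof. by rewrite /tail fineK// (fin_num_measure (@normal_prob R 0 1)). Qed.

(** The two tails differ by the mass of []x, y]], on which the density lies between [0] and
    [normal_peak 1]. *)
Let tail_lip (x y : R) : x <= y ->
  tail y <= tail x <= tail y + normal_peak 1 * (y - x).
Proof.
move=> xy.
have e : (`]x, +oo[ = `]x, y] `|` `]y, +oo[ :> set R)%classic.
  by rewrite -itv_bndbnd_setU// bnd_simp.
have := tailE x; rewrite e measureU//=; last first.
  apply/seteqP; split => // z [] /=; rewrite !in_itv/= andbT.
  by move=> /andP[_ /le_lt_trans h] /h; rewrite ltxx.
have /andP[] := @integral_itvoc_bounds R (normal_pdf 0 1) x y 0 (normal_peak 1)
  xy (lexx 0) (measurable_normal_pdf 0 1)
  (fun z _ => introT andP (conj (normal_pdf_ge0 0 1 z)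
                                (normal_pdf_ub 0 z (oner_neq0 R)))).
rewrite tailE -/(normal_prob 0 1 `]x, y]).
have -> : normal_prob 0 1 `]x, y] = (fine (normal_prob 0 1 `]x, y]))%:E.
  by rewrite fineK// (fin_num_measure (@normal_prob R 0 1)).
rewrite mul0r -EFinD !lee_fin => h0 h1 [<-].
by rewrite lerDr h0 addrC lerD2l h1.
Qed.

Let tail_continuous : continuous tail.
Proof.
move=> x; apply/cvgrPdist_le => e e0.
have p0 : 0 < @normal_peak R 1 by exact: normal_peak_gt0.
near=> y.
have : `|x - y| <= e / normal_peak 1.
  near: y; apply: cvgr_dist_le; first exact: cvg_id.
  by rewrite divr_gt0.
rewrite ler_pdivlMr// => xy; apply: le_trans xy.
have [le|/ltW le] := leP x y; have /andP[h1 h2] := tail_lip _ _ le.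
- by rewrite ger0_norm ?subr_ge0// ler0_norm ?subr_le0//; lra.
- by rewrite ler0_norm ?subr_le0// ger0_norm ?subr_ge0//; lra.
Unshelve. all: by end_near. Qed.

Let tail0 : tail 0 = 1 / 2.
Proof.
have := @integral_normal_pdf R 0 1.
rewrite ge0_symfun_integralT//=; first last.
- by move=> x /=; rewrite !normal_pdfE// /normal_fun !subr0 sqrrN.
- exact: continuous_normal_pdf.
- by move=> x; exact: normal_pdf_ge0.
rewrite -set_itvcy -integral_itv_obnd_cbnd; last first.
  by apply/measurable_EFinP/measurable_funTS; exact: measurable_normal_pdf.
rewrite -/(normal_prob 0 1 `]0, +oo[) tailE -EFinM => -[]; lra.
Qed.

(** The tail is continuous, equals [1 / 2] at [0] and vanishes at infinity, so some point has tail
    [beta] and [xget] does not fall back on its default [0]. Being nonincreasing, the tail is at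
    least [1 / 2] at nonpositive points, so every solution is positive. *)
Lemma normal_upper_quantile_gt0 (beta : R) : 0 < beta < 1 / 2 ->
  0 < normal_upper_quantile beta.
Proof.
move=> /andP[b0 b1].
have [b tb] : exists b, tail b < beta /\ 0 <= b.
  have := @cvg_ccdfy0 _ _ _ (normal_prob 0 1 : probability _ R) idR.
  move=> /fine_cvgP[_ /cvgrPdist_lt /(_ _ b0)] h.
  near (pinfty_nbhs R) => b; exists b; split; last by near: b; exact: nbhs_pinfty_ge.
  have : `|0 - tail b| < beta by near: b; exact: h.
  by rewrite sub0r normrN => /(le_lt_trans (ler_norm _)).
case: tb => tb bge.
have [||c _ tc] := @IVT R tail 0 b beta bge.
    exact: continuous_subspaceT.
  by rewrite minEle maxEle; case: ifP; rewrite tail0; lra.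
rewrite /normal_upper_quantile; case: xgetP => [z -> /= hz|]; last first.
  by move=> /(_ c); case; rewrite /= tailE tc.
rewrite ltNge; apply/negP => z0; have /andP[+ _] := tail_lip _ _ z0.
by move: hz; rewrite tailE => -[->]; rewrite tail0; lra.
Unshelve. all: by end_near. Qed.

End normal_tail.

(** * Sample quantiles through counting functions *)

(** The entries at most [t] of a sorted list form an initial segment, whose length is the count. *)
Lemma nth_sorted_le_count (R : realDomainType) (s : seq R) (t : R) (i : nat) :
  sorted <=%R s -> (i < size s)%N ->
  (nth 0 s i <= t) = (i < count (fun x => (x <= t)%R) s)%N.
Proof.
elim: s i => // x s IH i /= pxs ilt.
have ss := path_sorted pxs.
have xs : all (fun y => x <= y) s by apply: order_path_min pxs; exact: le_trans.
have [xt|tx] := leP x t.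
  by case: i ilt => [|i] ilt /=; rewrite ?xt// ltnS IH.
have -> : count (fun y => y <= t) s = 0%N.
  apply/eqP; rewrite -leqn0 leqNgt -has_count -all_predC.
  by apply: sub_all xs => y /= xy; rewrite -ltNge (lt_le_trans tx).
rewrite addn0 ltn0; case: i ilt => [|i] ilt /=; apply/negbTE; rewrite -ltNge//.
by apply: lt_le_trans tx _; move/all_nthP : xs; apply.
Qed.

(** The ceiling of [phi * size s] lies between [1] and [size s], so its predecessor is a valid
    index; being below the count then means that the ceiling, hence [phi * size s] itself, is at
    most the count. *)
Lemma sample_quantile_le (R : realType) (phi : R) (s : seq R) (t : R) :
  0 < phi <= 1 -> (0 < size s)%N ->
  (sample_quantile phi s <= t) =
  (phi * (size s)%:R <= (count (fun x => x <= t) s)%:R).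
Proof.
move=> /andP[phi0 phi1] s0; rewrite /sample_quantile.
have sR : 0 < (size s)%:R :> R by rewrite ltr0n.
have c0 : (0 < Num.ceil (phi * (size s)%:R))%R by rewrite ceil_gt0 mulr_gt0.
have : (Num.ceil (phi * (size s)%:R) <= size s)%R.
  by rewrite ceil_le_int ler_piMl.
have -> (c : nat) : (phi * (size s)%:R <= c%:R) = (Num.ceil (phi * (size s)%:R) <= c)%R.
  by rewrite ceil_le_int.
case: (Num.ceil _) c0 => // -[|k] //= _; rewrite !lez_nat => ks.
rewrite nth_sorted_le_count ?size_sort//; last exact: sort_le_sorted.
by have /permP -> := permEl (perm_sort <=%R s).
Qed.

Lemma measurable_indic_ler (R : realType) (d : measure_display)
  (T : measurableType d) (Y : T -> R) (x : R) : measurable_fun setT Y ->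
  measurable_fun setT (fun w => (Y w <= x)%R%:R : R).
Proof.
move=> mY; rewrite (_ : (fun _ => _) = \1_(Y @^-1` `]-oo, x])).
  apply: measurable_indic; rewrite -[X in measurable X]setTI.
  exact: mY.
apply/funext => w; rewrite indicE; congr (_%:R)%R; congr nat_of_bool.
by apply/idP/idP; rewrite in_setE/= in_itv.
Qed.

Lemma natr_count (R : pzSemiRingType) (I : Type) (a : pred I) (s : seq I) :
  (count a s)%:R = \sum_(i <- s) (a i)%:R :> R.
Proof. by rewrite -sum1_count natr_sum big_mkcond; apply: eq_bigr => i _; case: (a i). Qed.

(** The rays []x, +oo[] generate the Borel sets, and the quantile exceeds [x] exactly when the
    measurable count at [x] stays below [phi * size s]. *)
Lemma measurable_sample_quantile (R : realType) (d : measure_display)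
  (T : measurableType d) (I : Type) (phi : R) (Y : I -> T -> R) (s : seq I) :
  0 < phi <= 1 -> (forall i, measurable_fun setT (Y i)) ->
  measurable_fun setT (fun w => sample_quantile phi [seq Y i w | i <- s]).
Proof.
move=> hphi mY; have [/size0nil ->|s0] := posnP (size s).
  exact: (measurable_cst (sample_quantile phi [::])).
apply: (measurability _ (RGenOInfty.measurableE R)) => _ [_ [x ->] <-].
rewrite setTI.
pose N w : R := \sum_(i <- s) (Y i w <= x)%R%:R.
have mN : measurable_fun setT N.
  by apply: measurable_sum => i; exact: measurable_indic_ler.
rewrite (_ : _ @^-1` _ = N @^-1` `]-oo, phi * (size s)%:R[).
  by rewrite -[X in measurable X]setTI; exact: mN.
apply/seteqP; split => w /=; rewrite !in_itv/= andbT [x < _]ltNge sample_quantile_le ?size_map//;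
  by rewrite -ltNge count_map natr_count.
Qed.

(** * Second-moment bound for the number of events that occur *)

(** Pairwise independence gives the count the variance [N * (q - q ^+ 2)], which is at most
    [N * q]. *)
Lemma chebyshev_count (R : realType) (d : measure_display)
  (T : measurableType d) (P : probability T R) (J : finType)
  (A : J -> set T) (q lambda : R) :
  0 <= q -> 0 < lambda -> (forall j, measurable (A j)) ->
  (forall j, P (A j) = q%:E) ->
  (forall j k, j != k -> P (A j `&` A k) = (q ^+ 2)%:E) ->
  (P [set w | (lambda <= `|\sum_j \1_(A j) w - #|J|%:R * q|)%R]
    <= (#|J|%:R * q / lambda ^+ 2)%:E)%E.
Proof.
move=> q0 l0 mA PA PAA; set N : R := #|J|%:R.
have N0 : 0 <= N by rewrite ler0n.
pose S w : R := \sum_j \1_(A j) w.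
have mS : measurable_fun setT S.
  by apply: measurable_sum => j; exact: measurable_indic.
set B := [set w | _].
have mB : measurable B.
  have mg : measurable_fun setT (fun w => `|S w - N * q|).
    by apply: measurableT_comp => //; exact: measurable_funB.
  rewrite (_ : B = setT `&` (fun w => `|S w - N * q|) @^-1` `[lambda, +oo[).
    exact: mg.
  by rewrite setTI; apply/seteqP; split => w /=; rewrite in_itv/= andbT.
(* The pointwise Chebyshev inequality, with the square expanded and the cross term moved to the
   left: both sides are sums of nonnegative terms, so they can be integrated termwise. *)
have key w : lambda ^+ 2 * \1_B w + 2 * N * q * S w <=
    \sum_j \sum_k \1_(A j `&` A k) w + N ^+ 2 * q ^+ 2.
  have -> : \sum_j \sum_k \1_(A j `&` A k) w = S w ^+ 2.
    rewrite expr2 mulr_suml; apply: eq_bigr => j _; rewrite mulr_sumr.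
    by apply: eq_bigr => k _; rewrite indicI.
  suff : lambda ^+ 2 * \1_B w <= (S w - N * q) ^+ 2 by nra.
  rewrite indicE; have [|_] := boolP (w \in B); last by rewrite mulr0 sqr_ge0.
  rewrite inE /B /= -/(S w) -/N mulr1 => h.
  by rewrite -[leRHS]real_normK ?num_real// ler_sqr ?nnegrE// ltW.
have IE (U : set T) : measurable U -> (\int[P]_w (\1_U w)%:E = P U)%E.
  by move=> mU; rewrite integral_indic// setIT.
have IS : (\int[P]_w (S w)%:E = (N * q)%:E)%E.
  under eq_integral do rewrite -sumEFin.
  rewrite ge0_integral_sum//=; last first.
    by move=> j; exact/measurable_EFinP/measurable_indic.
  under eq_bigr do rewrite IE// PA.
  by rewrite sumEFin sumr_const -mulr_natl.
have mSS : measurable_fun setT (fun w => \sum_j \sum_k \1_(A j `&` A k) w : R).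
  apply: measurable_sum => j; apply: measurable_sum => k.
  by apply: measurable_indic; exact: measurableI.
have ISS : (\int[P]_w (\sum_j \sum_k \1_(A j `&` A k) w)%:E
    = (N * q + (N ^+ 2 - N) * q ^+ 2)%:E)%E.
  under eq_integral do rewrite -sumEFin.
  rewrite ge0_integral_sum//=; last 2 first.
    move=> j; apply/measurable_EFinP/measurable_sum => k.
    by apply: measurable_indic; exact: measurableI.
    by move=> j w _; rewrite lee_fin sumr_ge0.
  have e j : (\int[P]_w (\sum_k \1_(A j `&` A k) w)%:E
      = (q + (N - 1) * q ^+ 2)%:E)%E.
    under eq_integral do rewrite -sumEFin.
    rewrite ge0_integral_sum//=; last first.
      by move=> k; apply/measurable_EFinP/measurable_indic; exact: measurableI.
    under eq_bigr => k _ do rewrite (IE _ (measurableI _ _ (mA j) (mA k))).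
    (* The diagonal term contributes [q], each of the [N - 1] others [q ^+ 2]. *)
    rewrite (bigD1 j)//= setIid PA.
    under eq_bigr => k jk do rewrite PAA 1?eq_sym//.
    rewrite sumEFin sumr_const cardC1 -mulr_natl -EFinD.
    have -> // : (#|J|.-1)%:R = N - 1 :> R.
    by rewrite /N -subn1 natrB//; apply/card_gt0P; exists j.
  under eq_bigr do rewrite e.
  rewrite sumEFin sumr_const -mulr_natl -/N; congr EFin; nra.
have : (\int[P]_w (lambda ^+ 2 * \1_B w + 2 * N * q * S w)%:E <=
   \int[P]_w (\sum_j \sum_k \1_(A j `&` A k) w + N ^+ 2 * q ^+ 2)%:E)%E.
  apply: ge0_le_integral => //=.
  - move=> w _; rewrite lee_fin addr_ge0// mulr_ge0 ?sqr_ge0 ?mulr_ge0//.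
    by apply: sumr_ge0.
  - by apply/measurable_EFinP/measurable_funD; apply: measurable_funM => //;
      exact: measurable_indic.
  - by apply/measurable_EFinP/measurable_funD.
  - by move=> w _; rewrite lee_fin.
have -> : (\int[P]_w (lambda ^+ 2 * \1_B w + 2 * N * q * S w)%:E =
    (lambda ^+ 2)%:E * P B + (2 * N * q * (N * q))%:E)%E.
  transitivity (\int[P]_w ((lambda ^+ 2)%:E * (\1_B w)%:E +
      (2 * N * q)%:E * (S w)%:E))%E; first exact: eq_integral.
  rewrite ge0_integralD//=.
  - rewrite !ge0_integralZl_EFin//= ?sqr_ge0 ?mulr_ge0//.
    + by rewrite IE// IS -EFinM.
    + by move=> w _; rewrite lee_fin sumr_ge0.
    + exact/measurable_EFinP.
    + exact/measurable_EFinP/measurable_indic.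
  - by move=> w _; rewrite -EFinM lee_fin mulr_ge0 ?sqr_ge0.
  - by apply/measurable_EFinP/measurable_funM => //; exact: measurable_indic.
  - by move=> w _; rewrite -EFinM lee_fin mulr_ge0 ?mulr_ge0// sumr_ge0.
  - exact/measurable_EFinP/measurable_funM.
have -> : (\int[P]_w (\sum_j \sum_k \1_(A j `&` A k) w + N ^+ 2 * q ^+ 2)%:E =
    (N * q + (N ^+ 2 - N) * q ^+ 2 + N ^+ 2 * q ^+ 2)%:E)%E.
  under eq_integral do rewrite EFinD.
  rewrite ge0_integralD//=.
  - by rewrite ISS integral_cst//= probability_setT mule1.
  - by move=> w _; rewrite lee_fin sumr_ge0// => j _; rewrite sumr_ge0.
  - exact/measurable_EFinP.
  - by move=> w _; rewrite lee_fin mulr_ge0// sqr_ge0.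
rewrite -(@fineK _ (P B)) ?fin_num_measure// -EFinM -EFinD !lee_fin => h.
rewrite ler_pdivlMr ?exprn_gt0//; nra.
Qed.

(** * Locating a quantile on a finite grid *)

(** Rounding [x / delta] up and shifting by [K] yields a natural number at most [K + K]. *)
Lemma grid_point (R : realType) (K : nat) (delta x : R) :
  0 < delta -> `|x| <= K%:R * delta ->
  exists k : 'I_(K + K).+1, x <= (k%:R - K%:R) * delta <= x + delta.
Proof.
move=> d0 xK.
pose z := Num.ceil (x / delta + K%:R).
have dn : delta != 0 by rewrite gt_eqF.
have /andP[xl xu] : - K%:R <= x / delta <= K%:R.
  by rewrite ler_pdivlMr// ler_pdivrMr// mulNr -ler_norml.
have z0 : (0 <= z)%R by rewrite ceil_ge0// (lt_le_trans (ltrN10 _))//; lra.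
have zK : (z <= (K + K)%N)%R.
  by rewrite ceil_le_int -pmulrn natrD; lra.
have /andP[zl zu] : ((z - 1)%:~R < x / delta + K%:R <= z%:~R).
  by rewrite /z ceil_itv.
rewrite intrB in zl.
case: z z0 zK zl zu => // k _; rewrite lez_nat => kK; rewrite -pmulrn => zl zu.
have kK' : (k < (K + K).+1)%N by rewrite ltnS.
exists (Ordinal kK') => /=.
rewrite -ler_pdivrMr// -[x + delta](divfK dn) ler_pM2r// mulrDl divff//.
by apply/andP; split; lra.
Qed.

(** Here [c] is a counting function, [a] the threshold that defines the quantile [y], and [v] the
    normalised deviation of the count at [p]. On the grid [c - a] is close to [sigma * (v + u)], so
    it changes sign near [u = - v], which locates [y]. *)
Lemma quantile_linearization (R : realType) (K : nat)
  (p f0 r delta M a sigma y v : R) (c : R -> R) :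
  0 < f0 -> 0 < r -> 0 < delta -> 0 < sigma ->
  (forall t, (y <= t) = (a <= c t)) ->
  `|v| <= M -> M + 4 * delta <= K%:R * delta ->
  (forall k : 'I_(K + K).+1, let u := (k%:R - K%:R) * delta in
     `|c (p + u * r / f0) - a - sigma * (v + u)| <= 2 * delta * sigma) ->
  `|y - (p - v * r / f0)| <= 4 * delta * (r / f0).
Proof.
move=> f00 r0 d0 s0 yc vM MK H.
have rf : 0 < r / f0 by rewrite divr_gt0.
move: vM; rewrite ler_norml => /andP[vM1 vM2].
(* A margin of [2 * delta] above [- v] absorbs the error allowed by [H], so the count reaches [a]
   there. *)
have [k1 /andP[k1l k1u]] : exists k : 'I_(K + K).+1,
    - v + 2 * delta <= (k%:R - K%:R) * delta <= - v + 2 * delta + delta.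
  by apply: grid_point => //; rewrite ler_norml; apply/andP; split; lra.
(* Here [v + u] is at most [- 3 * delta], so the count stays strictly below [a] despite the
   error. *)
have [k2 /andP[k2l k2u]] : exists k : 'I_(K + K).+1,
    - v - 4 * delta <= (k%:R - K%:R) * delta <= - v - 4 * delta + delta.
  by apply: grid_point => //; rewrite ler_norml; apply/andP; split; lra.
move: (H k1) (H k2) => /=; rewrite !ler_norml.
set u1 := (k1%:R - _) * delta in k1l k1u *.
set u2 := (k2%:R - _) * delta in k2l k2u *; clearbody u1 u2.
move=> /andP[h1 _] /andP[_ h2].
have y1 : y <= p + u1 * r / f0.
  rewrite yc; have : 0 <= sigma * (v + u1 - 2 * delta) by rewrite mulr_ge0 ?(ltW s0)//; lra.
  by nra.
have y2 : p + u2 * r / f0 < y.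
  rewrite ltNge yc -ltNge.
  have : 0 < sigma * (- v - u2 - 2 * delta) by rewrite mulr_gt0//; lra.
  by nra.
move: y1 y2; rewrite -!mulrA; set g := r / f0 in rf *.
move=> y1 y2.
have g1 : u1 * g <= (- v + 3 * delta) * g by rewrite ler_pM2r//; lra.
have g2 : (- v - 4 * delta) * g <= u2 * g by rewrite ler_pM2r//; lra.
have g3 : 0 < delta * g by rewrite mulr_gt0.
by apply/andP; split; lra.
Qed.

(** * Pairwise independence and the union bound *)

Lemma mutually_independent_pair (R : realType) (d : measure_display)
  (T : measurableType d) (P : probability T R) (I : finType)
  (Y : I -> T -> R) (j k : I) (A B : set R) :
  mutually_independent P Y -> j != k -> measurable A -> measurable B ->
  P (Y j @^-1` A `&` Y k @^-1` B) = (P (Y j @^-1` A) * P (Y k @^-1` B))%E.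
Proof.
move=> indY jk mA mB.
(* The whole line at every other index contributes a factor [1]. *)
pose C l := if l == j then A else if l == k then B else setT.
have mC l : measurable (C l) by rewrite /C; case: ifP => // _; case: ifP.
have Cj : C j = A by rewrite /C eqxx.
have Ck : C k = B by rewrite /C eq_sym (negbTE jk) eqxx.
have := indY C mC; rewrite (bigD1 j)//= (bigD1 k)/=; last by rewrite eq_sym.
rewrite big1 ?mule1 ?Cj ?Ck => [<-|l /andP[lj lk]]; last first.
  by rewrite /C (negbTE lj) (negbTE lk) preimage_setT probability_setT.
congr (P _); apply/seteqP; split => w /=.
  move=> [wA wB] l _ /=; rewrite /C.
  by case: eqP => [->//|_]; case: eqP => [->//|_].
by move=> wC; rewrite -Cj -Ck; split; exact: wC.
Qed.

Lemma union_bound (R : realType) (d : measure_display)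
  (T : measurableType d) (P : probability T R) (I : finType)
  (A : I -> set T) (U : set T) (b : I -> R) :
  measurable U -> (forall i, measurable (A i)) ->
  (forall w, U w -> exists i, A i w) -> (forall i, P (A i) <= (b i)%:E)%E ->
  (P U <= (\sum_i b i)%:E)%E.
Proof.
move=> mU mA UA PA.
have mbig (s : seq I) : measurable (\big[setU/set0]_(i <- s) A i).
  by apply: bigsetU_measurable.
have le s : (P (\big[setU/set0]_(i <- s) A i) <= (\sum_(i <- s) b i)%:E)%E.
  elim: s => [|i s IH]; first by rewrite !big_nil measure0.
  by rewrite !big_cons (le_trans (measureU2 _ _ _))//= EFinD leeD.
apply: (@le_trans _ _ (P (\big[setU/set0]_i A i))); last exact: le.
apply: le_measure; rewrite ?inE// => w /UA[i Aiw].
by rewrite (bigD1 i)//=; left.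
Qed.

(** * The common distribution function and concentration of empirical counts *)

Section common_law.
Variables (R : realType) (d : measure_display) (T : measurableType d).
Variables (P : probability T R) (f : R -> R).
Hypotheses (mf : measurable_fun setT f) (f_ge0 : forall x, 0 <= f x).

Definition law_cdf (t : R) : R :=
  fine (\int[lebesgue_measure]_(x in `]-oo, t]) (f x)%:E)%E.

Let F := law_cdf.

Section one_variable.
Variable X : {RV P >-> R}.
Hypothesis lawX : forall B : set R, measurable B ->
  P (X @^-1` B) = (\int[lebesgue_measure]_(x in B) (f x)%:E)%E.

Lemma law_cdfE t : P (X @^-1` `]-oo, t]) = (F t)%:E.
Proof.
rewrite /F /law_cdf -lawX// fineK// fin_num_measure//.
exact: measurable_funPTI.
Qed.

Lemma law_cdf_itv a b : a <= b -> P (X @^-1` `]a, b]) = (F b - F a)%:E.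
Proof.
move=> ab.
have mX (B : set R) : measurable B -> measurable (X @^-1` B).
  by move=> mB; exact: measurable_funPTI.
have : P (X @^-1` `]-oo, b]) = (P (X @^-1` `]-oo, a]) + P (X @^-1` `]a, b]))%E.
  rewrite -measureU//; [|exact: mX|exact: mX|].
    by rewrite -preimage_setU -itv_bndbnd_setU.
  apply/seteqP; split => // z [] /=; rewrite !in_itv/=.
  by move=> h /andP[/lt_le_trans/(_ h)]; rewrite ltxx.
rewrite !law_cdfE -[P (X @^-1` `]a, b])]fineK; last first.
  by rewrite fin_num_measure//; exact: mX.
by rewrite -EFinD => -[->]; rewrite addrC addKr.
Qed.

(** Continuity traps [f] near [p] between [f p - k] and [f p + k]; integrating between [p] and
    [p + h] bounds the increment of [F]. *)
Lemma law_cdf_derivative p kappa : {for p, continuous f} -> 0 < f p ->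
  0 < kappa -> exists2 e, 0 < e & forall h, `|h| <= e ->
    `|F (p + h) - F p - f p * h| <= kappa * `|h|.
Proof.
move=> cf fp0 k0.
(* Capping at [f p] keeps the lower bound [f p - k] nonnegative, as [integral_itvoc_bounds]
   requires. *)
pose k := Num.min kappa (f p).
have kpos : 0 < k by rewrite lt_min k0.
have kf : k <= f p by rewrite ge_min lexx orbT.
have kk : k <= kappa by rewrite ge_min lexx.
have /cvgrPdist_le/(_ _ kpos) := cf.
move=> /nbhs_ballP[e /= e0 He].
exists (e / 2); first by rewrite divr_gt0.
have inc a b : a <= b -> `|a - p| <= e / 2 -> `|b - p| <= e / 2 ->
    (f p - k) * (b - a) <= F b - F a <= (f p + k) * (b - a).
  move=> ab; rewrite !ler_norml => ha hb.
  rewrite -!lee_fin -law_cdf_itv// lawX//.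
  apply: integral_itvoc_bounds => //; first by rewrite subr_ge0.
  move=> x; rewrite in_itv/= => /andP[ax xb].
  have := He x; rewrite /ball/= => Hx.
  have /Hx : `|p - x| < e by rewrite ltr_norml; lra.
  by rewrite ler_norml; lra.
move=> h hh; have ph : p + h - p = h by rewrite addrC addKr.
have pe : `|p - p| <= e / 2 by rewrite subrr normr0 ltW// divr_gt0.
have phe : `|p + h - p| <= e / 2 by rewrite ph.
have [h0|h0] := leP 0 h.
  have /andP[l u] := inc p (p + h) ltac:(by rewrite lerDl) pe phe.
  rewrite ph in l u; rewrite (ger0_norm h0) ler_norml; apply/andP; split; nra.
have /andP[l u] := inc (p + h) p ltac:(by rewrite gerDl ltW) phe pe.
rewrite -[p - _]opprB ph in l u.
rewrite (ltr0_norm h0) ler_norml; apply/andP; split; nra.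
Qed.

End one_variable.

Section sample.
Variables (J : finType) (Y : J -> {RV P >-> R}).
Hypothesis lawY : forall j (B : set R), measurable B ->
  P (Y j @^-1` B) = (\int[lebesgue_measure]_(x in B) (f x)%:E)%E.
Hypothesis indY : forall j k (B : set R), j != k -> measurable B ->
  P (Y j @^-1` B `&` Y k @^-1` B) = (P (Y j @^-1` B) * P (Y k @^-1` B))%E.

Definition ecount (t : R) (w : T) : R := \sum_j (Y j w <= t)%R%:R.

Lemma measurable_ecount t : measurable_fun setT (ecount t).
Proof. by apply: measurable_sum => j; exact: measurable_indic_ler. Qed.

Lemma chebyshev_ecount (t lambda : R) : 0 < lambda ->
  (P [set w | (lambda <= `|ecount t w - #|J|%:R * F t|)%R]
    <= (#|J|%:R * F t / lambda ^+ 2)%:E)%E.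
Proof.
move=> l0.
have F0 : 0 <= F t.
  by rewrite fine_ge0// integral_ge0// => x _; rewrite lee_fin.
have mY j (B : set R) : measurable B -> measurable (Y j @^-1` B).
  by move=> mB; exact: measurable_funPTI.
have YE w : ecount t w = \sum_j \1_(Y j @^-1` `]-oo, t]) w.
  apply: eq_bigr => j _; rewrite indicE; congr (_%:R)%R; congr nat_of_bool.
  by apply/idP/idP; rewrite in_setE/= in_itv.
under eq_set do rewrite YE.
apply: chebyshev_count => // [j|j|j k jk].
- exact: mY.
- exact: (law_cdfE _ (lawY j)).
- by rewrite indY// (law_cdfE _ (lawY j)) (law_cdfE _ (lawY k)) -EFinM expr2.
Qed.

(** The increment counts the sample points between [a] and [b], so its variance is controlled by
    [F b - F a]. Over a distance of order [1 / sqrt m] this makes the fluctuation of the count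
    negligible against [sqrt m]. *)
Lemma chebyshev_ecount_increment (a b lambda : R) : 0 < lambda ->
  (P [set w | (lambda <= `|ecount b w - ecount a w - #|J|%:R * (F b - F a)|)%R]
    <= (#|J|%:R * `|F b - F a| / lambda ^+ 2)%:E)%E.
Proof.
wlog ab : a b / a <= b.
  move=> H l0; have [ab|/ltW ba] := leP a b; first exact: H.
  rewrite [`|F b - _|]distrC [X in P X](_ : _ = [set w | lambda <=
    `|ecount a w - ecount b w - #|J|%:R * (F a - F b)|]); first exact: H.
  apply: eq_set => w; rewrite -normrN; congr (is_true (_ <= `|_|)).
  by lra.
move=> l0.
have mY j (B : set R) : measurable B -> measurable (Y j @^-1` B).
  by move=> mB; exact: measurable_funPTI.
(* An empty sample is treated apart, since [F a <= F b] is read off the law of some [Y j0]. *)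
have [J0|/card_gt0P[j0 _]] := posnP #|J|.
  rewrite J0 !mul0r.
  rewrite [X in P X](_ : _ = set0) ?measure0//.
  apply/seteqP; split => // w /=; rewrite /ecount !big1 ?subr0 ?normr0 ?leNgt ?l0//.
  - by move=> j; have := card0_eq J0 j; rewrite inE.
  - by move=> j; have := card0_eq J0 j; rewrite inE.
have F0 : 0 <= F b - F a by rewrite -lee_fin -(law_cdf_itv _ (lawY j0)).
have YE w : ecount b w - ecount a w = \sum_j \1_(Y j @^-1` `]a, b]) w.
  rewrite -sumrB; apply: eq_bigr => j _; rewrite indicE.
  have -> : (w \in Y j @^-1` `]a, b]) = (a < Y j w <= b).
    by apply/idP/idP; rewrite in_setE/= in_itv.
  have [Ya|aY] := leP (Y j w) a; first by rewrite (le_trans Ya ab) subrr.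
  by rewrite subr0.
under eq_set do rewrite YE.
rewrite (ger0_norm F0); apply: chebyshev_count => // [j|j|j k jk].
- exact: mY.
- exact: (law_cdf_itv _ (lawY j)).
- by rewrite indY// (law_cdf_itv _ (lawY j))// (law_cdf_itv _ (lawY k))// -EFinM expr2.
Qed.

End sample.
End common_law.

(** * Cancellation of the linear terms for a fixed outcome *)

(** Each sub-window is linearized at scale [s] with deviation [v i], the whole window at scale
    [n * s] with the average [V] of the [v i]. Both [y_avg] and [y_exact] are thus within
    [4 * delta * (s^-1 / f0)] of the same point. *)
Lemma quantile_gap (R : realType) (T : Type) (n m K : nat) (phi p f0 delta M : R)
  (F : R -> R) (X : 'I_n -> 'I_m -> T -> R) (w : T) :
  (0 < n)%N -> (0 < m)%N -> 0 < phi < 1 -> 0 < f0 -> 0 < delta ->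
  M + 4 * delta <= K%:R * delta -> F p = phi ->
  let s := Num.sqrt m%:R in
  let C i t := \sum_j (X i j w <= t)%R%:R in
  let u (k : 'I_(K + K).+1) := (k%:R - K%:R) * delta in
  let t k := p + u k * s^-1 / f0 in
  (forall k, `|F (t k) - F p - u k * s^-1| <= delta * s^-1) ->
  (forall i, `|C i p - m%:R * F p| <= M * s) ->
  (forall i k, `|C i (t k) - C i p - m%:R * (F (t k) - F p)| <= delta * s) ->
  `|y_avg phi X w - y_exact phi X w| <= 8 * delta * (s^-1 / f0).
Proof.
move=> n0 m0 /andP[phi0 phi1] f00 d0 MK Fp s C u t hF hC0 hC.
have phi01 : 0 < phi <= 1 by rewrite phi0 ltW.
have s0 : 0 < s by rewrite sqrtr_gt0 ltr0n.
have sn : s != 0 by rewrite gt_eqF.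
have mE : m%:R = s * s by rewrite -expr2 sqr_sqrtr.
have nR : 0 < n%:R :> R by rewrite ltr0n.
have nn : n%:R != 0 :> R by rewrite gt_eqF.
have ss : s * s^-1 = 1 by rewrite divff.
pose v i := (C i p - m%:R * phi) / s.
have vM i : `|v i| <= M.
  by rewrite normrM normfV (gtr0_norm s0) ler_pdivrMr// -Fp.
have vs i : s * v i = C i p - m%:R * phi by rewrite mulrC divfK.
have grid i k : `|C i (t k) - phi * m%:R - s * (v i + u k)| <= 2 * delta * s.
  rewrite mulrDr vs.
  (* Split into the random fluctuation of the increment and the linearization error of [F]; each is
     at most [delta * s]. *)
  have -> : C i (t k) - phi * m%:R - (C i p - m%:R * phi + s * u k) =
    (C i (t k) - C i p - m%:R * (F (t k) - F p)) +
    m%:R * (F (t k) - F p - u k * s^-1).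
    have -> : m%:R * (F (t k) - F p - u k * s^-1) =
      m%:R * (F (t k) - F p) - s * u k * (s * s^-1) by rewrite mE; lra.
    by rewrite ss; lra.
  apply: le_trans (ler_normD _ _) _.
  have -> : 2 * delta * s = delta * s + s * s * (delta * s^-1).
    have -> : s * s * (delta * s^-1) = s * delta * (s * s^-1) by lra.
    by rewrite ss; lra.
  by apply: lerD => //; rewrite normrM mE gtr0_norm ?mulr_gt0// ler_pM2l ?mulr_gt0.
have sub_lin i : `|subwindow_quantile phi X i w - (p - v i * s^-1 / f0)|
    <= 4 * delta * (s^-1 / f0).
  apply: (@quantile_linearization R K _ _ _ _ M (phi * m%:R) s _ _ (C i)) => //.
  - by rewrite invr_gt0.
  - move=> x; rewrite /subwindow_quantile sample_quantile_le// ?size_map -?enumT ?size_enum_ord//.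
    by rewrite natr_count big_map big_enum.
  - by move=> k; exact: grid.
pose V := n%:R^-1 * \sum_i v i.
have VM : `|V| <= M.
  rewrite normrM normfV (gtr0_norm nR) mulrC ler_pdivrMr//.
  apply: le_trans (ler_norm_sum _ _ _) _.
  by apply: (le_trans (ler_sum _ (fun i _ => vM i))); rewrite sumr_const card_ord mulr_natr.
have whole : `|y_exact phi X w - (p - V * s^-1 / f0)| <= 4 * delta * (s^-1 / f0).
  apply: (@quantile_linearization R K _ _ _ _ M (phi * (n * m)%:R) (n%:R * s) _ _
     (fun x => \sum_i C i x)) => //.
  - by rewrite invr_gt0.
  - by rewrite mulr_gt0.
  - move=> x; rewrite /y_exact sample_quantile_le// ?size_image ?card_prod
      ?card_ord ?muln_gt0 ?n0//.
    by rewrite natr_count big_image /= pair_bigA.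
  - move=> k /=.
    have -> : \sum_i C i (p + (k%:R - K%:R) * delta * s^-1 / f0) - phi * (n * m)%:R
       - n%:R * s * (V + (k%:R - K%:R) * delta) =
       \sum_i (C i (t k) - phi * m%:R - s * (v i + u k)).
      have sE : \sum_i s * (v i + u k) = s * (\sum_i v i + n%:R * u k).
        by rewrite -mulr_sumr big_split/= sumr_const card_ord mulr_natl.
      rewrite !sumrB sE sumr_const card_ord -[(_ * _) *+ n]mulr_natl.
      rewrite -/(u k) -/(t k) [(n * m)%:R]natrM -[\sum_i v i](mulVKf nn) -/V.
      by lra.
    apply: le_trans (ler_norm_sum _ _ _) _.
    apply: (le_trans (ler_sum _ (fun i _ => grid i k))).
    by rewrite sumr_const card_ord -mulr_natl; lra.
have avg : `|y_avg phi X w - (p - V * s^-1 / f0)| <= 4 * delta * (s^-1 / f0).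
  have -> : y_avg phi X w - (p - V * s^-1 / f0) =
      n%:R^-1 * \sum_i (subwindow_quantile phi X i w - (p - v i * s^-1 / f0)).
    have vE : \sum_i v i * s^-1 / f0 = (\sum_i v i) * s^-1 / f0.
      by rewrite !mulr_suml.
    rewrite !sumrB vE sumr_const card_ord -[p *+ n]mulr_natl.
    by rewrite !mulrBr mulKf// /y_avg /V !mulrA.
  rewrite normrM normfV (gtr0_norm nR) mulrC ler_pdivrMr//.
  apply: le_trans (ler_norm_sum _ _ _) _.
  by apply: (le_trans (ler_sum _ (fun i _ => sub_lin i))); rewrite sumr_const card_ord mulr_natr.
rewrite -[X in `|X|](subrKA (p - V * s^-1 / f0)).
apply: le_trans (ler_normD _ _) _; rewrite [X in _ + X]distrC.
by apply: (le_trans (lerD avg whole)); lra.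
Qed.

(** * Probability estimates and the limit *)

Lemma le_limn_einf (R : realType) (u : nat -> \bar R) (l : \bar R) :
  (\forall m \near \oo, (l <= u m)%E) -> (l <= limn_einf u)%E.
Proof.
move=> [N _ lu]; rewrite limn_einf_lim.
apply: lime_ge; first exact: is_cvg_einfs.
near=> m; apply: le_ereal_inf_tmp => _ [k /= mk <-].
by apply: lu => /=; rewrite (leq_trans _ mk)//; near: m; exists N.
Unshelve. all: by end_near. Qed.

(** Outside finitely many bad events [quantile_gap] applies. Chebyshev bounds each of them, and [M]
    and [tau] are chosen so that the deviations at [p] and the increments each cost at most
    [eta / 2] in total. *)
Lemma quantile_gap_negligible (R : realType) (d : measure_display)
  (T : measurableType d) (P : probability T R) (n : nat) (phi : R)
  (X : forall m : nat, 'I_n -> 'I_m -> {RV P >-> R})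
  (f : R -> R) (p c eta : R) :
  (0 < n)%N -> 0 < phi < 1 ->
  measurable_fun setT f -> (forall x, 0 <= f x) ->
  (forall m (i : 'I_n) (j : 'I_m) (B : set R), measurable B ->
     P (X m i j @^-1` B) = (\int[lebesgue_measure]_(x in B) (f x)%:E)%E) ->
  (forall m, mutually_independent P (fun k : 'I_n * 'I_m => X m k.1 k.2)) ->
  (\int[lebesgue_measure]_(x in `]-oo, p]) (f x)%:E)%E = phi%:E ->
  {for p, continuous f} -> 0 < f p -> 0 < c -> 0 < eta ->
  \forall m \near \oo, ((1 - eta)%:E <=
    P [set w | (`|y_avg phi (fun i j => X m i j) w -
                  y_exact phi (fun i j => X m i j) w|
                <= c / (Num.sqrt (n * m)%:R * f p))%R])%E.
Proof.
move=> n0 phi01 mf f_ge0 lawX indX Fp cf fp0 c0 eta0.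
pose F := law_cdf R f.
have Fphi : F p = phi by rewrite /F /law_cdf Fp.
have /andP[phi0 phi1] := phi01.
have nR : 0 < n%:R :> R by rewrite ltr0n.
(* Chosen so that the gap [8 * delta / (sqrt m * f p)] is exactly the claimed bound. *)
pose delta := c / (8 * Num.sqrt n%:R).
have sn0 : 0 < Num.sqrt n%:R :> R by rewrite sqrtr_gt0.
have d0 : 0 < delta by rewrite divr_gt0// mulr_gt0.
have deltaE : delta = c / (8 * Num.sqrt n%:R) by [].
clearbody delta.
(* The summand [1] ensures that [M ^+ 2] is at least [2 * n / eta]. *)
pose M := 1 + 2 * n%:R / eta.
have ne0 : 0 < 2 * n%:R / eta by rewrite divr_gt0// mulr_gt0.
have M0 : 0 < M by rewrite /M; lra.
have M2 : n%:R * (phi / M ^+ 2) <= eta / 2.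
  rewrite mulrA ler_pdivrMr ?exprn_gt0//.
  have : 2 * n%:R / eta <= M ^+ 2 by rewrite /M; nra.
  rewrite ler_pdivrMr// => h.
  have : n%:R * phi <= n%:R by rewrite ler_piMr ?ltW.
  by lra.
pose K := (Num.trunc ((M + 4 * delta) / delta)).+1.
have MK : M + 4 * delta <= K%:R * delta.
  by rewrite -ler_pdivrMr// ltW// truncnS_gt.
have K0 : 0 < K%:R :> R by rewrite ltr0n.
pose u (k : 'I_(K + K).+1) : R := (k%:R - K%:R) * delta.
have uK k : `|u k| <= K%:R * delta.
  rewrite normrM (gtr0_norm d0) ler_pM2r// ler_norml.
  have : (k%:R : R) <= (K + K)%:R by rewrite ler_nat -ltnS.
  have : 0 <= (k%:R : R) by rewrite ler0n.
  by rewrite natrD; lra.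
(* Since [u k] is at most [K * delta] in absolute value, the tolerance [f p / K] makes the error at
   [t k] at most [delta / sqrt m]. *)
have [e e0 He] := @law_cdf_derivative R d T P f mf (X 1%N (Ordinal n0) ord0)
  (lawX 1%N _ _) p (f p / K%:R) cf fp0 (divr_gt0 fp0 K0).
(* With this value the [n * (2 K + 1)] increment events, of probability at most [tau / delta ^+ 2]
   each, total [eta / 2]. *)
pose tau := eta * delta ^+ 2 / (2 * n%:R * (K + K).+1%:R).
have tau0 : 0 < tau by apply: divr_gt0; rewrite !mulr_gt0 ?ltr0n//.
(* [1 / sqrt m <= rho] keeps the grid where the derivative estimate [He] is
   valid, and keeps the increments [F t - F p <= 2 K delta / sqrt m] below [tau] *)
pose rho := Num.min (e * f p / (K%:R * delta)) (tau / (2 * K%:R * delta)).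
have rho0 : 0 < rho.
  by rewrite lt_min !divr_gt0 ?mulr_gt0.
near=> m.
have m0 : (0 < m)%N by near: m; exists 1%N.
have mR : 0 < m%:R :> R by rewrite ltr0n.
set s := Num.sqrt m%:R : R.
have s0 : 0 < s by rewrite sqrtr_gt0.
have rs : s^-1 <= rho.
  rewrite invf_ple ?posrE//.
  have : (rho^-1) ^+ 2 <= m%:R by near: m; exact: nbhs_infty_ger.
  by rewrite -ler_sqrt// sqrtr_sqr ger0_norm// invr_ge0 ltW.
have /andP[rs1 rs2] : (s^-1 <= e * f p / (K%:R * delta))
    && (s^-1 <= tau / (2 * K%:R * delta)) by rewrite -le_min.
pose t k := p + u k * s^-1 / f p.
have sV0 : 0 < s^-1 by rewrite invr_gt0.
have usK k : `|u k * s^-1| <= K%:R * delta * s^-1.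
  by rewrite normrM (gtr0_norm sV0) ler_pM2r.
have hF k : `|F (t k) - F p - u k * s^-1| <= delta * s^-1.
  have hn : `|u k * s^-1 / f p| = `|u k * s^-1| / f p.
    by rewrite normrM normfV (gtr0_norm fp0).
  have := He (u k * s^-1 / f p); rewrite hn ler_pdivrMr//.
  rewrite [f p * _]mulrC divfK ?gt_eqF// => h.
  have /h /le_trans : `|u k * s^-1| <= e * f p.
    apply: le_trans (usK k) _.
    by move: rs1; rewrite ler_pdivlMr ?mulr_gt0// mulrC.
  apply; rewrite mulrC mulrA divfK ?gt_eqF// ler_pdivrMr//.
  by apply: le_trans (usK k) _; lra.
have hI k : `|F (t k) - F p| <= tau.
  rewrite -[F (t k) - F p](subrK (u k * s^-1)).
  apply: le_trans (ler_normD _ _) _; apply: (le_trans (lerD (hF k) (usK k))).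
  move: rs2; rewrite ler_pdivlMr ?mulr_gt0//; apply: le_trans.
  have : 1 <= K%:R :> R by rewrite ler1n.
  have : 0 < delta * s^-1 by rewrite mulr_gt0.
  by nra.
pose Y i (j : 'I_m) : {RV P >-> R} := X m i j.
have lawY i j (B : set R) : measurable B ->
    P (Y i j @^-1` B) = (\int[lebesgue_measure]_(x in B) (f x)%:E)%E.
  exact: lawX.
have indY i j k (B : set R) : j != k -> measurable B ->
    P (Y i j @^-1` B `&` Y i k @^-1` B) = (P (Y i j @^-1` B) * P (Y i k @^-1` B))%E.
  move=> jk mB.
  apply: (@mutually_independent_pair _ _ _ _ _ _ (i, j) (i, k) _ _ (indX m)) => //.
  by rewrite xpair_eqE eqxx.
pose N i x w := ecount R d T P 'I_m (Y i) x w.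
have mN i x : measurable_fun setT (N i x) by exact: measurable_ecount.
have mnorm (g : T -> R) : measurable_fun setT g ->
    measurable_fun setT (fun w => `|g w|).
  by move=> mg; exact: measurableT_comp.
have mge (g : T -> R) x : measurable_fun setT g -> measurable [set w | x <= `|g w|].
  move=> /mnorm mg.
  rewrite (_ : [set w | _] = setT `&` (fun w => `|g w|) @^-1` `[x, +oo[); first exact: mg.
  by rewrite setTI; apply/seteqP; split => w /=; rewrite in_itv/= andbT.
have mle (g : T -> R) x : measurable_fun setT g -> measurable [set w | `|g w| <= x].
  move=> /mnorm mg.
  rewrite (_ : [set w | _] = setT `&` (fun w => `|g w|) @^-1` `]-oo, x]); first exact: mg.
  by rewrite setTI; apply/seteqP; split => w /=; rewrite in_itv/=.
(* The bad events: outside them the two count hypotheses of [quantile_gap] hold. *)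
pose A0 i := [set w | M * s <= `|N i p w - #|'I_m|%:R * F p|].
pose A1 i k := [set w | delta * s <=
  `|N i (t k) w - N i p w - #|'I_m|%:R * (F (t k) - F p)|].
have mA0 i : measurable (A0 i) by apply: mge; exact: measurable_funB.
have mA1 i k : measurable (A1 i k).
  by apply: mge; apply: measurable_funB => //; exact: measurable_funB.
have s2 : s ^+ 2 = m%:R by rewrite sqr_sqrtr.
have PA0 i : (P (A0 i) <= (phi / M ^+ 2)%:E)%E.
  apply: (le_trans (chebyshev_ecount _ _ _ _ _ f_ge0 _ _ (lawY i) (indY i) _ _ _)).
    exact: mulr_gt0.
  rewrite lee_fin card_ord -/F Fphi exprMn s2.
  by rewrite [_ * m%:R]mulrC -mulf_div divff ?mul1r// gt_eqF.
have PA1 i k : (P (A1 i k) <= (tau / delta ^+ 2)%:E)%E.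
  apply: (le_trans (chebyshev_ecount_increment _ _ _ _ _ _ _ (lawY i) (indY i) _ _ _ _)).
    exact: mulr_gt0.
  rewrite lee_fin card_ord -/F exprMn s2 [_ * m%:R]mulrC -mulf_div divff ?gt_eqF// mul1r.
  by rewrite ler_pM2r// invr_gt0 exprn_gt0.
set E := [set w | _].
have mE : measurable E.
  have phi01' : 0 < phi <= 1 by rewrite phi0 ltW.
  apply: mle; apply: measurable_funB.
    apply: measurable_funM => //; apply: measurable_sum => i.
    exact: measurable_sample_quantile.
  exact: (@measurable_sample_quantile R d T _ phi (fun k : 'I_n * 'I_m => X m k.1 k.2)).
have PE : (P (~` E) <= eta%:E)%E.
  pose A (a : 'I_n + 'I_n * 'I_(K + K).+1) :=
    match a with inl i => A0 i | inr ik => A1 ik.1 ik.2 end.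
  pose b (a : 'I_n + 'I_n * 'I_(K + K).+1) :=
    match a with inl i => phi / M ^+ 2 | inr ik => tau / delta ^+ 2 end.
  apply: (@le_trans _ _ (\sum_a b a)%:E).
    apply: (@union_bound _ _ _ _ _ A) => [|[i|[i k]]|w nE|[i|[i k]]] //=.
      exact: measurableC.
    apply: contrapT => /forallNP nA; apply: nE; rewrite /E /=.
    have := @quantile_gap R T n m K phi p (f p) delta M F (fun i j => X m i j) w
      n0 m0 phi01 fp0 d0 MK Fphi hF.
    rewrite -/s => /(_ _ _)/le_trans; apply.
    - move=> i; have := nA (inl i); rewrite /A/= /A0 /= card_ord => /negP.
      by rewrite -ltNge => /ltW.
    - move=> i k; have := nA (inr (i, k)); rewrite /A/= /A1 /= card_ord => /negP.
      by rewrite -ltNge => /ltW.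
    rewrite natrM sqrtrM ?ler0n// -/s deltaE.
    rewrite le_eqVlt; apply/orP; left; apply/eqP; field.
    by rewrite !gt_eqF.
  rewrite lee_fin big_sumType/= !sumr_const card_prod !card_ord.
  have -> : eta = eta / 2 + eta / 2 by lra.
  apply: lerD; first by rewrite -[(_ / _) *+ _]mulr_natl.
  rewrite -[(_ / _) *+ _]mulr_natl natrM le_eqVlt; apply/orP; left; apply/eqP; rewrite /tau; field.
  by rewrite !gt_eqF ?ltr0n.
have -> : P E = (1 - P (~` E))%E by rewrite -probability_setC ?setCK//; exact: measurableC.
by rewrite EFinB leeB.
Unshelve. all: by end_near. Qed.

Theorem theorem1 (R : realType) (d : measure_display) (T : measurableType d)
  (P : probability T R) (n : nat) (phi : R)
  (X : forall m : nat, 'I_n -> 'I_m -> {RV P >-> R})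
  (f : R -> R) (p_phi : R) :
  (0 < n)%N -> 0 < phi < 1 ->
  (* f is a probability density, common to all x_{i,j} *)
  measurable_fun setT f -> (forall x, 0 <= f x) ->
  (forall m (i : 'I_n) (j : 'I_m) (B : set R), measurable B ->
     P (X m i j @^-1` B) = (\int[lebesgue_measure]_(x in B) (f x)%:E)%E) ->
  (* for each m, the n*m data points are independent *)
  (forall m, mutually_independent P (fun k : 'I_n * 'I_m => X m k.1 k.2)) ->
  (* p_phi is the phi-quantile, f continuous there with f(p_phi) > 0 *)
  (\int[lebesgue_measure]_(x in `]-oo, p_phi]) (f x)%:E)%E = phi%:E ->
  {for p_phi, continuous f} -> 0 < f p_phi ->
  (forall alpha : R, 0 < alpha < 1 ->
    ((1 - alpha)%:E <= limn_einf (fun m : nat =>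
      P [set w | (`|y_avg phi (fun i j => X m i j) w - y_exact phi (fun i j => X m i j) w|
                 <= 2 * normal_upper_quantile (alpha / 2) * Num.sqrt (phi * (1 - phi))
                    / (Num.sqrt (n * m)%:R * f p_phi))%R]))%E)
  /\
  ((1 - 5 / 100 : R)%:E <= limn_einf (fun m : nat =>
      P [set w | (`|y_avg phi (fun i j => X m i j) w - y_exact phi (fun i j => X m i j) w|
                 <= 2 * (196 / 100) * Num.sqrt (phi * (1 - phi))
                    / (Num.sqrt (n * m)%:R * f p_phi))%R]))%E.
Proof.
move=> n0 phi01 mf f0 lawX indX Fp cf fp0.
have sq0 : 0 < Num.sqrt (phi * (1 - phi)).
  by case/andP: phi01 => ? ?; rewrite sqrtr_gt0 mulr_gt0// subr_gt0.
(* Both claims take [c] to be the numerator of the bound and [eta] to be [alpha] or [5 / 100]; it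
   remains to see that [c] is positive, which for general [alpha] rests on [alpha / 2 < 1 / 2]. *)
split=> [alpha /andP[a0 a1]|]; apply: le_limn_einf;
  apply: (@quantile_gap_negligible R d T P n phi X f) => //.
- rewrite mulr_gt0// mulr_gt0// normal_upper_quantile_gt0//.
  by apply/andP; split; lra.
- by rewrite mulr_gt0//; lra.
Qed.
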